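(* Let $n,k$ be integers with $0\le k<n$, and let $$f(x)=\frac{a_nx^n+a_{n-1}x^{n-1}+\dots+a_1x+a_0}{b_{n-k}x^{n-k}+b_{n-k-1}x^{n-k-1}+\dots+b_1x+b_0}$$ be a rational function with real coefficients, where $a_n\neq 0$ and $b_{n-k}\neq 0$. Put $b_i=0$ for $i<0$. Then the asymptote of $f$, i.e. the polynomial $g$ with $\lim_{x\to\infty}\left(f(x)-g(x)\right)=0$, is $$g(x)=\sum_{\alpha=0}^{k}\theta_\alpha x^{k-\alpha},\qquad \theta_\alpha=(-1)^\alpha\,\frac{\det M_\alpha}{b_{n-k}^{\alpha+1}}\quad(0\le\alpha\le k),$$ where $M_\alpha$ is the $(\alpha+1)\times(\alpha+1)$ matrix $$M_\alpha=\begin{pmatrix} a_n & a_{n-1} & \dots & a_{n-\alpha}\\ b_{n-k} & b_{n-k-1} & \dots & b_{n-k-\alpha}\\ 0 & b_{n-k} & \dots & b_{n-k-\alpha+1}\\ \vdots & \vdots & \ddots & \vdots\\ 0 & 0 & \dots & b_{n-k-1}\end{pmatrix}.$$ In particular $M_0=(a_n)$, so $\theta_0=a_n/b_{n-k}$.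
   Context: The asymptote (horizontal, oblique or curvilinear) of a rational function $f$ whose numerator has degree $n$ and whose denominator has degree $n-k$ is the polynomial $g(x)=\sum_{\alpha=0}^k\theta_\alpha x^{k-\alpha}$ such that $\lim_{x\to\infty}(f(x)-g(x))=0$. With rows and columns of $M_\alpha$ indexed by $0,1,\dots,\alpha$, the entries are: row $0$, column $j$ is $a_{n-j}$; for $1\le i\le\alpha$, row $i$, column $j$ is $b_{n-k-(j-i+1)}$ if $j\ge i-1$ and is $0$ if $j<i-1$. The convention $b_i=0$ for $i<0$ is used throughout. *)

(* Defs.v *)
From HB Require Import structures.
From mathcomp Require Import all_boot all_order all_algebra.
From mathcomp Require Import all_classical all_reals all_analysis.

Set Implicit Arguments.
Unset Strict Implicit.
Unset Printing Implicit Defensive.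

Import Order.TTheory GRing.Theory Num.Theory.
Import numFieldNormedType.Exports.

Local Open Scope classical_set_scope.
Local Open Scope ring_scope.

(* [a] and [b] are coefficient families: only [a 0], ..., [a n] and
   [b 0], ..., [b (n - k)] are ever used. *)

Definition ratfun (R : realType) (n k : nat) (a b : nat -> R) (x : R) : R :=
  (\sum_(i < n.+1) a i * x ^+ i) / (\sum_(i < (n - k).+1) b i * x ^+ i).

(* The convention b_i = 0 for i < 0. *)
Definition coefz (R : realType) (b : nat -> R) (i : int) : R :=
  if i is Posz m then b m else 0.

(* In the rows i >= 1 the index n - k - (j - i + 1) is computed in [int]:
   it may be negative, whereas [j + 1 < i] would make it exceed n - k. *)
Definition asym_mx (R : realType) (n k : nat) (a b : nat -> R) (alpha : nat) :
    'M[R]_(alpha.+1) :=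
  \matrix_(i < alpha.+1, j < alpha.+1)
    if i == 0%N :> nat then a (n - j)%N
    else if (i <= j.+1)%N
         then coefz b (n%:Z - k%:Z - (j%:Z - i%:Z + 1))
         else 0.

Definition theta (R : realType) (n k : nat) (a b : nat -> R) (alpha : nat) : R :=
  (-1) ^+ alpha * (\det (asym_mx n k a b alpha) / b (n - k)%N ^+ alpha.+1).

(* [g] is an asymptote of [f] along [F], where [F] is the filter of
   neighbourhoods of +oo or of -oo. *)
Definition is_asymptote (R : realType) (F : set_system R)
    (f : R -> R) (g : {poly R}) : Prop :=
  f x - g.[x] @[x --> F] --> (0 : R).

(* Main.v *)
Require Import Defs.
From HB Require Import structures.
From mathcomp Require Import all_boot all_order all_algebra.
From mathcomp Require Import all_classical all_reals all_analysis.
From mathcomp Require Import ring zify.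

Set Implicit Arguments.
Unset Strict Implicit.
Unset Printing Implicit Defensive.

Import Order.TTheory GRing.Theory Num.Theory.
Import numFieldNormedType.Exports.

Local Open Scope classical_set_scope.
Local Open Scope ring_scope.

(** Let A and B be the numerator and the denominator, m = n - k the degree
    of B, and A = Q B + S the Euclidean division.  Then f - Q = S / B tends to
    0 at both infinities, and a polynomial tending to 0 there is zero, so the
    quotient Q is the only asymptote ([asymptote_divp]).  Both facts come from
    one limit, [cvg_horner_div]: if size p <= size q, then p / q tends to the
    ratio of the coefficients of p and q at the degree of q.

    For the coefficients q_j of x^(k-j) in Q, no recursion has to be solved.
    As deg S < m, comparing the coefficients of x^(n-s) in A = Q B + S for
    s <= k gives a_(n-s) = sum_(j <= s) q_j b_(m-(s-j)): the row
    (a_n, ..., a_(n-alpha)) is (q_0, ..., q_alpha) T, where T is the upper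
    triangular Toeplitz matrix of B with b_m on its diagonal.  The other rows
    of M_alpha are the rows of T except the last one.  Hence M_alpha = C T,
    where C has first row (q_0, ..., q_alpha) and, below, the first alpha rows
    of the identity ([asym_mxE]).  Since det C = (-1)^alpha q_alpha and
    det T = b_m^(alpha+1), this gives theta_alpha = q_alpha
    ([theta_divp]). *)

(** * Polynomials at infinity *)

Section AtInfinity.
Context {R : realType} {F : set_system R} {FF : ProperFilter F}.
Hypothesis F_inv : (x^-1 : R) @[x --> F] --> (0 : R).
Hypothesis F_neq0 : \forall x \near F, x != 0.
Implicit Types p q g : {poly R}.

(** For x nonzero, p(x) / x^d is the reversed polynomial of p evaluated at
    1/x, so the limit is the value of a polynomial at 0.  This treats both
    infinities at once. *)
Lemma cvg_horner_divXn p (d : nat) : (size p <= d.+1)%N ->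
  p.[x] / x ^+ d @[x --> F] --> p`_d.
Proof.
move=> szp; pose r := \poly_(i < d.+1) p`_(d - i).
have r0 : r.[0] = p`_d by rewrite horner_coef0 coef_poly subn0.
have rE : {near F, (fun x => r.[x^-1]) =1 (fun x => p.[x] / x ^+ d)}.
  near=> x; have x0 : x != 0 by near: x.
  rewrite (horner_coef_wide _ szp) horner_poly mulr_suml.
  rewrite (reindex_inj rev_ord_inj) /=; apply: eq_bigr => i _.
  have le_id : (i <= d)%N by rewrite -ltnS.
  rewrite subSS subKn // -mulrA; congr (_ * _).
  have -> : x ^+ d = x ^+ (d - i) * x ^+ i by rewrite -exprD subnK.
  by rewrite exprVn invfM mulrCA divff ?mulr1 ?expf_neq0.
rewrite -r0; apply: (cvg_trans (near_eq_cvg rE)).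
exact: (cvg_comp _ _ F_inv (@continuous_horner R r 0)).
Unshelve. all: by end_near. Qed.

(** Divide p and q by x^d, d the degree of q.  For size p < size q the limit
    is 0, and for p = q it is 1. *)
Lemma cvg_horner_div p q : q != 0 -> (size p <= size q)%N ->
  p.[x] / q.[x] @[x --> F] --> p`_(size q).-1 / lead_coef q.
Proof.
move=> q0 szpq; set d := (size q).-1.
have szq : size q = d.+1 by rewrite /d prednK // size_poly_gt0.
have cp : p.[x] / x ^+ d @[x --> F] --> p`_d.
  by apply: cvg_horner_divXn; rewrite -szq.
have cq : q.[x] / x ^+ d @[x --> F] --> lead_coef q.
  by rewrite lead_coefE; apply: cvg_horner_divXn; rewrite szq.
have lq0 : lead_coef q != 0 by rewrite lead_coef_eq0.
apply: cvg_trans (cvgM cp (cvgV lq0 cq)); apply: near_eq_cvg.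
near=> x; have x0 : x != 0 by near: x.
by rewrite /= invfM invrK mulrACA mulVf ?mulr1 ?expf_neq0.
Unshelve. all: by end_near. Qed.

(** As q / q tends to 1, it is eventually nonzero, and so is q. *)
Lemma near_horner_neq0 q : q != 0 -> \forall x \near F, q.[x] != 0.
Proof.
move=> q0; have := cvg_horner_div q0 (leqnn _).
rewrite -lead_coefE divff ?lead_coef_eq0 // => /cvgr_neq0 /(_ (oner_neq0 _)).
by apply: filterS => x; rewrite mulf_eq0 negb_or => /andP[].
Qed.

(** If p were nonzero, 1 / p would have a finite limit, so p * (1 / p) would
    tend to 0, whereas p / p tends to 1. *)
Lemma horner_cvg0_eq0 p : p.[x] @[x --> F] --> (0 : R) -> p = 0.
Proof.
move=> p_cvg0; apply/eqP/negPn/negP => p0.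
have c1 := cvg_horner_div p0 (leqnn _).
have szp : (size (1%:P : {poly R}) <= size p)%N.
  by rewrite size_polyC oner_neq0 size_poly_gt0.
have c0 := cvgM p_cvg0 (cvg_horner_div p0 szp).
have E : (fun x => p.[x] / p.[x]) = horner p \* (fun x => (1%:P).[x] / p.[x]).
  by apply/funext => x /=; rewrite hornerC mul1r.
rewrite E in c1; have : p`_(size p).-1 / lead_coef p
    = 0 * (1%:P`_(size p).-1 / lead_coef p).
  by apply: cvg_unique c1 (c0 _).
rewrite -lead_coefE divff ?lead_coef_eq0 // mul0r => /eqP.
by rewrite oner_eq0.
Qed.

Lemma asymptote_divp p q g : q != 0 ->
  is_asymptote F (fun x => p.[x] / q.[x]) g <-> g = p %/ q.
Proof.
move=> q0; have quot : is_asymptote F (fun x => p.[x] / q.[x]) (p %/ q).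
  have := cvg_horner_div q0 (ltnW (ltn_modpN0 p q0)).
  rewrite (@nth_default _ _ (p %% q)); last first.
    by rewrite -ltnS prednK ?size_poly_gt0 // ltn_modpN0.
  rewrite mul0r => c; apply: cvg_trans c; apply: near_eq_cvg.
  near=> x; have qx : q.[x] != 0 by near: x; exact: near_horner_neq0.
  by rewrite /= {2}(divp_eq p q) hornerD hornerM mulrDl mulfK // addrC addKr.
split=> [asym|-> //]; apply/eqP; rewrite -subr_eq0; apply/eqP.
apply: horner_cvg0_eq0.
rewrite -[0](subr0 0); apply: cvg_trans (cvgB quot asym); apply: near_eq_cvg.
by near=> x; rewrite hornerD hornerN !fctE; ring.
Unshelve. all: by end_near. Qed.

End AtInfinity.

Lemma cvg_inv_pinfty (R : realType) : (x^-1 : R) @[x --> +oo] --> (0 : R).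
Proof.
apply/(gtr0_cvgV0 (f := id)); last exact: cvg_id.
by apply: nbhs_pinfty_gt; exact: num_real.
Qed.

Lemma cvg_inv_ninfty (R : realType) : (x^-1 : R) @[x --> -oo] --> (0 : R).
Proof.
apply/(ltr0_cvgV0 (f := id)); last exact: cvg_id.
by apply: nbhs_ninfty_lt; exact: num_real.
Qed.

(** * Coefficients of a quotient as determinants *)

(** The identity matrix with its last row removed and [v] put on top: left
    multiplication by it shifts the rows of a matrix T down by one, drops the
    last one and puts the combination v T first. *)
Definition top_row_mx (R : comNzRingType) (d : nat) (v : nat -> R) :
    'M[R]_d.+1 :=
  \matrix_(i, j) if i == 0%N :> nat then v j else (i.-1 == j)%:R.

(** The only nonzero entry of the last column is [v d], in row 0, and its
    minor is the identity. *)
Lemma det_top_row_mx (R : comNzRingType) (d : nat) (v : nat -> R) :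
  \det (top_row_mx d v) = (-1) ^+ d * v d.
Proof.
rewrite (expand_det_col _ ord_max) (bigD1 ord0) //= big1 ?addr0; last first.
  move=> i i0; rewrite !mxE -val_eqE /= in i0 *; rewrite (negbTE i0).
  by rewrite ltn_eqF ?mul0r // -subn1 ltn_subLR ?lt0n // add1n ltn_ord.
rewrite mxE /= mulrC /cofactor; congr (_ * _).
suff -> : row' ord0 (col' ord_max (top_row_mx d v)) = 1%:M.
  by rewrite det1 mulr1.
apply/matrixP => i j; rewrite !mxE /= add0n.
by rewrite /bump leqNgt (ltn_ord j).
Qed.

(** For B of degree n - k, i <= k and j <= n, this is B_(n-k-(j-i)), read as 0
    where the index is negative or exceeds n - k.  Writing it as a coefficient
    of B * X^(k-i) handles both cases without case analysis and makes row i the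
    contribution of the monomial x^(k-i) of the quotient to the product
    with B. *)
Definition shift_coef (R : comNzRingType) (B : {poly R}) (n k i j : nat) : R :=
  (B * 'X^(k - i))`_(n - j).

Lemma poly_rev (R : nzRingType) (k : nat) (Q : {poly R}) :
    (size Q <= k.+1)%N ->
  Q = \sum_(j < k.+1) Q`_(k - j) *: 'X^(k - j).
Proof.
move=> szQ.
transitivity (\poly_(i < k.+1) Q`_i).
  apply/polyP => i; rewrite coef_poly; case: ltnP => // /(leq_trans szQ).
  exact: nth_default.
rewrite poly_def [RHS](reindex_inj rev_ord_inj) /=.
by apply: eq_bigr => i _; rewrite subSS subKn ?leq_ord.
Qed.

Section Quotient.
Variables (R : comNzRingType) (n k : nat) (B : {poly R}).
Hypotheses (le_kn : (k <= n)%N) (szB : size B = (n - k).+1).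

Lemma shift_coef_trig (i j : nat) :
  (j < i <= k)%N -> shift_coef B n k i j = 0.
Proof.
move=> /andP[ji ik]; rewrite /shift_coef coefMXn; case: ifP => // _.
by rewrite nth_default // szB; lia.
Qed.

Definition toeplitz_mx (alpha : nat) : 'M[R]_alpha.+1 :=
  \matrix_(i, j) shift_coef B n k i j.

Lemma det_toeplitz_mx (alpha : nat) : (alpha <= k)%N ->
  \det (toeplitz_mx alpha) = lead_coef B ^+ alpha.+1.
Proof.
move=> al_k; rewrite -det_tr det_trig.
  rewrite (eq_bigr (fun=> lead_coef B)) ?big_const_ord ?iter_mulr_1 //.
  move=> i _; rewrite !mxE /shift_coef coefMXn lead_coefE szB.
  have := ltn_ord i; rewrite ifF; last by lia.
  by move=> ?; congr (_`_ _); lia.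
apply/is_trig_mxP => i j ij; rewrite !mxE shift_coef_trig // ij.
by rewrite (leq_trans _ al_k) // -ltnS.
Qed.

(** The sum may stop at any [alpha] between [s] and [k] because the monomials
    x^(k-j) of Q with j > s only reach degrees below n - s in Q * B.  This lets
    all columns [s] of a matrix of size [alpha.+1] share the same sum, as a
    matrix product requires. *)
Lemma coef_mul_rev (Q : {poly R}) (s alpha : nat) :
    (size Q <= k.+1)%N -> (s <= alpha <= k)%N ->
  (Q * B)`_(n - s) = \sum_(j < alpha.+1) Q`_(k - j) * shift_coef B n k j s.
Proof.
move=> szQ /andP[s_al al_k].
have al_k1 : (alpha.+1 <= k.+1)%N by [].
rewrite (big_ord_widen _ (fun j => Q`_(k - j) * shift_coef B n k j s) al_k1).
rewrite [in LHS](poly_rev szQ) mulr_suml coef_sum [RHS]big_mkcond /=.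
apply: eq_bigr => j _; rewrite -scalerAl coefZ [_ * B]mulrC.
case: ltnP => // al_j; rewrite -/(shift_coef B n k j s).
by rewrite shift_coef_trig ?mulr0 // (leq_ltn_trans s_al) //= -ltnS.
Qed.

End Quotient.

Lemma size_divp_le (K : fieldType) (n k : nat) (p q : {poly K}) :
    (k <= n)%N -> (size p <= n.+1)%N -> size q = (n - k).+1 ->
  (size (p %/ q)%R <= k.+1)%N.
Proof.
move=> kn szp szq; have q0 : q != 0 by rewrite -size_poly_eq0 szq.
by rewrite size_divp // szq leq_subLR addnS subnK.
Qed.

(** For j < i - 1 both sides vanish, the right one because the index in B
    exceeds n - k.  For j >= i - 1 the integer index is negative exactly when
    n - j is smaller than the shift k - (i - 1), that is, when the coefficient
    of x^(n-j) lies below the lowest degree of the shifted polynomial. *)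
Lemma asym_entryE (R : realType) (n k i j : nat) (b : nat -> R) :
    (k <= n)%N -> (0 < i)%N -> (i.-1 <= k)%N -> (j <= k)%N ->
  (if (i <= j.+1)%N then coefz b (n%:Z - k%:Z - (j%:Z - i%:Z + 1)) else 0) =
  shift_coef (\poly_(l < (n - k).+1) b l) n k i.-1 j.
Proof.
case: i => // i kn _ /= ik jk; rewrite /shift_coef coefMXn coef_poly.
rewrite ltnS; case: (leqP i j) => ij; last first.
  by rewrite (_ : (n - j - (k - i) < (n - k).+1)%N = false) ?if_same //; lia.
have -> : (n%:Z - k%:Z - (j%:Z - i.+1%:Z + 1) = (n - k)%N%:Z - (j - i)%N%:Z)%R.
  by lia.
case: (leqP (j - i) (n - k)) => h.
  rewrite subzn // ifF ?ifT; try lia.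
  by congr b; lia.
rewrite ifT; last by lia.
by have -> : (n - k)%N%:Z - (j - i)%N%:Z = Negz (j - i - (n - k)).-1 by lia.
Qed.

(** The first row uses that the remainder has degree below n - k, so that
    it does not affect the coefficients of x^(n-j) for j <= k. *)
Lemma asym_mxE (R : realType) (n k alpha : nat) (a b : nat -> R)
    (A := \poly_(i < n.+1) a i) (B := \poly_(i < (n - k).+1) b i) :
    (k < n)%N -> b (n - k)%N != 0 -> (alpha <= k)%N ->
  asym_mx n k a b alpha =
    top_row_mx alpha (fun j => (A %/ B)`_(k - j)) *m toeplitz_mx n k B alpha.
Proof.
move=> kn bm al_k.
have szB : size B = (n - k).+1 by rewrite size_poly_eq.
have B0 : B != 0 by rewrite -size_poly_eq0 szB.
have szQ : (size (A %/ B)%R <= k.+1)%N.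
  by apply: size_divp_le szB => //; [exact: ltnW|exact: size_poly].
apply/matrixP => i j; rewrite !mxE.
have j_al : (j <= alpha)%N by rewrite -ltnS.
case: ifPn => [/eqP i0|i_neq0].
  under eq_bigr do rewrite !mxE i0 eqxx.
  rewrite -(@coef_mul_rev _ n k) //; last 2 first.
  - exact: ltnW.
  - by rewrite j_al.
  have : (A`_(n - j) = (A %/ B * B + A %% B)`_(n - j)) by rewrite -divp_eq.
  rewrite coefD (@nth_default _ _ (A %% B)) ?addr0.
    by rewrite coef_poly ltnS leq_subr.
  have := ltn_modpN0 A B0; rewrite szB ltnS => /leq_trans; apply.
  by apply: leq_sub2l; exact: leq_trans al_k.
have i_al : (i.-1 < alpha.+1)%N by rewrite (leq_ltn_trans (leq_pred i)).
rewrite (bigD1 (Ordinal i_al)) //= big1 ?addr0 => [|l l_ne];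
  rewrite !mxE (negbTE i_neq0).
  rewrite eqxx mul1r asym_entryE ?lt0n //; first exact: ltnW.
    exact: leq_trans al_k.
  exact: leq_trans al_k.
by rewrite eq_sym (_ : _ == _ = false) ?mul0r //; apply: negbTE.
Qed.

Lemma theta_divp (R : realType) (n k alpha : nat) (a b : nat -> R)
    (A := \poly_(i < n.+1) a i) (B := \poly_(i < (n - k).+1) b i) :
    (k < n)%N -> b (n - k)%N != 0 -> (alpha <= k)%N ->
  theta n k a b alpha = (A %/ B)`_(k - alpha).
Proof.
move=> kn bm al_k; have szB : size B = (n - k).+1 by rewrite size_poly_eq.
rewrite /theta asym_mxE // det_mulmx det_top_row_mx.
rewrite det_toeplitz_mx ?(ltnW kn) //.
rewrite lead_coefE szB coef_poly ltnSn mulfK ?expf_neq0 //.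
by rewrite mulrA -exprD addnn -signr_odd odd_double mul1r.
Qed.

(** * The asymptote *)

Lemma asymptote_theta (R : realType) (n k : nat) (a b : nat -> R)
    (F : set_system R) {FF : ProperFilter F} (g : {poly R}) :
    (k < n)%N -> b (n - k)%N != 0 ->
    (x^-1 : R) @[x --> F] --> (0 : R) -> (\forall x \near F, x != 0) ->
  is_asymptote F (ratfun n k a b) g <->
  g = \sum_(alpha < k.+1) theta n k a b alpha *: 'X^(k - alpha).
Proof.
move=> kn bm F_inv F_neq0.
pose A := \poly_(i < n.+1) a i; pose B := \poly_(i < (n - k).+1) b i.
have szB : size B = (n - k).+1 by rewrite size_poly_eq.
have B0 : B != 0 by rewrite -size_poly_eq0 szB.
have -> : ratfun n k a b = fun x => A.[x] / B.[x].
  by apply/funext => x; rewrite /ratfun !horner_poly.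
have szQ : (size (A %/ B)%R <= k.+1)%N.
  by apply: size_divp_le szB => //; [exact: ltnW|exact: size_poly].
under eq_bigr => i _ do rewrite theta_divp // -1?ltnS //.
rewrite -(poly_rev szQ); exact: asymptote_divp.
Qed.

Theorem mainTheorem1 (R : realType) (n k : nat) (a b : nat -> R)
    (hkn : (k < n)%N) (ha : a n != 0) (hb : b (n - k)%N != 0) :
  [/\ forall g : {poly R},
        is_asymptote +oo (ratfun n k a b) g <->
        g = \sum_(alpha < k.+1) theta n k a b alpha *: 'X^(k - alpha),
      forall g : {poly R},
        is_asymptote -oo (ratfun n k a b) g <->
        g = \sum_(alpha < k.+1) theta n k a b alpha *: 'X^(k - alpha),
      asym_mx n k a b 0 = (a n)%:M
    & theta n k a b 0 = a n / b (n - k)%N].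
Proof.
have M0 : asym_mx n k a b 0 = (a n)%:M.
  by apply/matrixP => i j; rewrite !mxE !ord1 /= subn0.
split=> [g|g||].
- apply: asymptote_theta => //; first exact: cvg_inv_pinfty.
  by apply: filterS (nbhs_pinfty_gt (real0 _)) => x /lt0r_neq0.
- apply: asymptote_theta => //; first exact: cvg_inv_ninfty.
  by apply: filterS (nbhs_ninfty_lt (real0 _)) => x /ltr0_neq0.
- exact: M0.
- by rewrite /theta M0 det_scalar expr0 mul1r !expr1.
Qed.
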